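(* Let $\mathscr{A}$ be a unital $C^*$-algebra, $\mathscr{E}$ a Hilbert $\mathscr{A}$-module, and $\mathscr{E}_1,\mathscr{E}_2$ ternary subspaces of $\mathscr{E}$ that are module independent. Suppose that $\langle\mathscr{E}_1,\mathscr{E}_1\rangle$ or $\langle\mathscr{E}_2,\mathscr{E}_2\rangle$ has the quasi extension property relative to $\mathscr{A}$. If $z\in\mathscr{E}_1\cap\mathscr{E}_2$ with $\|z\|=1$, then $|z|=1$, the unit of $\mathscr{A}$.
   Context: A state on a $C^*$-algebra is a positive linear functional of norm one; $S(\mathscr{B})$ is the set of states of $\mathscr{B}$. Hilbert $C^*$-modules are right modules with $\mathscr{A}$-valued inner product $\langle\cdot,\cdot\rangle$, $\mathscr{A}$-linear in the second variable, and $\|x\|=\|\langle x,x\rangle\|^{1/2}$; for $x\in\mathscr{E}$, $|x|=\langle x,x\rangle^{1/2}\in\mathscr{A}$. For a closed subspace $\mathscr{F}\subseteq\mathscr{E}$, $\langle\mathscr{F},\mathscr{F}\rangle$ is the closed linear span of $\{\langle x,y\rangle:x,y\in\mathscr{F}\}$. A closed subspace $\mathscr{F}$ of $\mathscr{E}$ is ternary if $\mathscr{F}\langle\mathscr{F},\mathscr{F}\rangle\subseteq\mathscr{F}$; then $\langle\mathscr{F},\mathscr{F}\rangle$ is a $C^*$-subalgebra of $\mathscr{A}$. Ternary subspaces $\mathscr{E}_1,\mathscr{E}_2$ of $\mathscr{E}$ are (Hilbert $C^*$-)module independent if there are constants $m,M>0$ such that for all states $\varphi_i\in S(\langle\mathscr{E}_i,\mathscr{E}_i\rangle)$,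 $i=1,2$, there is a state $\varphi\in S(\mathscr{A})$ with $m\,\varphi_i(|x|)\le\varphi(|x|)\le M\,\varphi_i(|x|^2)^{1/2}$ for all $x\in\mathscr{E}_i$, $i=1,2$. A $C^*$-subalgebra $\mathscr{B}\subseteq\mathscr{A}$ has the quasi extension property relative to $\mathscr{A}$ if no pure state of $\mathscr{A}$ annihilates $\mathscr{B}$. *)

(* Defs.v *)
From HB Require Import structures.
From mathcomp Require Import all_boot all_order all_algebra.
From mathcomp Require Import complex.
From mathcomp Require Import boolp classical_sets reals ereal constructive_ereal.
From mathcomp Require Import topology normedtype.

Set Implicit Arguments.
Unset Strict Implicit.
Unset Printing Implicit Defensive.

Import Order.TTheory GRing.Theory Num.Theory.
Import numFieldNormedType.Exports.

Local Open Scope classical_set_scope.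
Local Open Scope complex_scope.
Local Open Scope ring_scope.

(* Unital C*-algebras.  As in every [normedModType R[i]], the norm is
   [R[i]]-valued.  The library has no join of normed modules and rings (it
   would have to lie below [numDomainType]), so the algebra structure is put on
   [cstar_carrier] by instances below.  The algebras of the library satisfy
   [1 != 0], so only the zero algebra is left out. *)
Record cstarAlgType (R : realType) := CStarAlgType {
  cstar_space : completeNormedModType R[i];
  cstar_one : cstar_space;
  cstar_mul : cstar_space -> cstar_space -> cstar_space;
  cstar_mulA : associative cstar_mul;
  cstar_mul1r : left_id cstar_one cstar_mul;
  cstar_mulr1 : right_id cstar_one cstar_mul;
  cstar_mulDl : left_distributive cstar_mul +%R;
  cstar_mulDr : right_distributive cstar_mul +%R;
  cstar_one_neq0 : cstar_one != 0;
  cstar_scaleAl : forall (k : R[i]) a b,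
    k *: cstar_mul a b = cstar_mul (k *: a) b;
  cstar_scaleAr : forall (k : R[i]) a b,
    k *: cstar_mul a b = cstar_mul a (k *: b);
  cstar_star : cstar_space -> cstar_space;
  cstar_starK : involutive cstar_star;
  cstar_starD : forall a b, cstar_star (a + b) = cstar_star a + cstar_star b;
  cstar_starZ : forall (k : R[i]) a, cstar_star (k *: a) = k^* *: cstar_star a;
  cstar_starM : forall a b,
    cstar_star (cstar_mul a b) = cstar_mul (cstar_star b) (cstar_star a);
  cstar_normM : forall a b, `|cstar_mul a b| <= `|a| * `|b|;
  cstar_norm_star : forall a, `|cstar_mul (cstar_star a) a| = `|a| ^+ 2
}.

Definition cstar_carrier (R : realType) (A : cstarAlgType R) : Type :=
  cstar_space A.
Coercion cstar_carrier : cstarAlgType >-> Sortclass.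

Section CStarAlgebraInstances.
Context (R : realType) (A : cstarAlgType R).

HB.instance Definition _ :=
  CompleteNormedModule.copy (cstar_carrier A) (cstar_space A).
HB.instance Definition _ := GRing.Zmodule_isNzRing.Build (cstar_carrier A)
  (@cstar_mulA R A) (@cstar_mul1r R A) (@cstar_mulr1 R A)
  (@cstar_mulDl R A) (@cstar_mulDr R A) (cstar_one_neq0 A).
HB.instance Definition _ :=
  GRing.Lmodule_isLalgebra.Build R[i] (cstar_carrier A) (@cstar_scaleAl R A).
HB.instance Definition _ :=
  GRing.Lalgebra_isAlgebra.Build R[i] (cstar_carrier A) (@cstar_scaleAr R A).

End CStarAlgebraInstances.

Section CStarAlgebraTheory.
Context {R : realType} {A : cstarAlgType R}.
Implicit Types (a b : A) (B : set A) (phi psi : A -> R[i]).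

Definition star a : A := cstar_star a.

Definition spectrum a : set R[i] :=
  [set k | ~ exists b, b * (a - k%:A) = 1 /\ (a - k%:A) * b = 1].

(* [0 <= k] in [R[i]] says that [k] is real and nonnegative. *)
Definition cstar_pos a := star a = a /\ spectrum a `<=` [set k | 0 <= k].

(* The positive square root of a positive element. *)
Definition cstar_sqrt a : A := xget 0 [set b | cstar_pos b /\ b ^+ 2 = a].

(* Functionals on a subalgebra [B] are represented by functions on [A] whose
   values outside [B] are never used; the functionals on [A] are the case
   [B = setT]. *)
Definition linear_on B phi :=
  forall (k : R[i]) a b, B a -> B b -> phi (k *: a + b) = k * phi a + phi b.

Definition positive_on B phi := forall b, B b -> 0 <= phi (star b * b).

Definition norm_on B phi : \bar R :=
  ereal_sup [set (complex.Re `|phi b|)%:E | b in [set b | B b /\ `|b| <= 1]].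

Definition state_on B phi :=
  [/\ linear_on B phi, positive_on B phi & norm_on B phi = 1%E].

Definition state phi := state_on setT phi.

(* Extreme points of the convex set of states. *)
Definition pure_state phi :=
  state phi /\
  forall (t : R) psi1 psi2, 0 < t < 1 -> state psi1 -> state psi2 ->
    (forall a, phi a = t%:C * psi1 a + (1 - t)%:C * psi2 a) ->
    psi1 = phi /\ psi2 = phi.

Definition quasi_extension_property B :=
  ~ exists phi, pure_state phi /\ (forall b, B b -> phi b = 0).

End CStarAlgebraTheory.

(* [ract x a] is the right action [x a]. *)
HB.mixin Record isHilbertModule (R : realType) (A : cstarAlgType R) E
    & CompleteNormedModule R[i] E := {
  ract : E -> A -> E;
  inner : E -> E -> A;
  ractDl : forall x y a, ract (x + y) a = ract x a + ract y a;
  ractDr : forall x a b, ract x (a + b) = ract x a + ract x b;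
  ractA : forall x a b, ract (ract x a) b = ract x (a * b);
  ract1 : forall x, ract x 1 = x;
  ractZl : forall (k : R[i]) x a, ract (k *: x) a = k *: ract x a;
  ractZr : forall (k : R[i]) x a, ract x (k *: a) = k *: ract x a;
  innerD : forall x y z, inner x (y + z) = inner x y + inner x z;
  innerZ : forall (k : R[i]) x y, inner x (k *: y) = k *: inner x y;
  inner_ract : forall x y a, inner x (ract y a) = inner x y * a;
  inner_star : forall x y, star (inner x y) = inner y x;
  inner_pos : forall x, cstar_pos (inner x x);
  inner_eq0 : forall x, inner x x = 0 -> x = 0;
  norm_inner : forall x : E, `|x| ^+ 2 = `|inner x x|
}.

#[short(type="hilbertModType")]
HB.structure Definition HilbertModule (R : realType) (A : cstarAlgType R) :=
  {E of isHilbertModule R A E & CompleteNormedModule R[i] E}.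

Section Subspaces.
Context {K : numFieldType} {V : normedModType K}.

Definition subspace (F : set V) :=
  F 0 /\ forall (k : K) x y, F x -> F y -> F (k *: x + y).

Definition closed_span (S : set V) : set V := closure (smallest subspace S).

End Subspaces.

Section HilbertModuleTheory.
Context {R : realType} {A : cstarAlgType R} {E : hilbertModType A}.
Implicit Types (x y : E) (F : set E).

Definition modulus x : A := cstar_sqrt (inner x x).

Definition inner_span F : set A :=
  closed_span [set c | exists x y, [/\ F x, F y & c = inner x y]].

Definition ternary_subspace F :=
  [/\ subspace F, closed F &
      forall x (a : A), F x -> inner_span F a -> F (ract x a)].

(* The inequalities are in [R[i]]: both sides are nonnegative reals, since
   [modulus x] and its square are positive elements of [inner_span F] for
   [x] in [F]. *)
Definition state_bounds (m M : R) F (phiF phi : A -> R[i]) :=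
  forall x, F x ->
    m%:C * phiF (modulus x) <= phi (modulus x) /\
    phi (modulus x) <= M%:C * sqrtC (phiF (modulus x ^+ 2)).

Definition module_independent (E1 E2 : set E) :=
  exists m M : R, [/\ 0 < m, 0 < M &
    forall phi1 phi2 : A -> R[i],
      state_on (inner_span E1) phi1 -> state_on (inner_span E2) phi2 ->
      exists phi : A -> R[i],
        [/\ state phi, state_bounds m M E1 phi1 phi &
            state_bounds m M E2 phi2 phi]].

End HilbertModuleTheory.

(* Main.v *)
(* Let [x] be a nonzero element of [E1] and [E2]; then [<x, x>] is invertible.
   Otherwise a pure state [psi] of [A] vanishes at [<x, x>]. By the quasi
   extension property (say for [E2]) [psi] does not vanish on [<E2, E2>], so a
   multiple [phi2] of it is a state there, with [phi2 (|x|^2) = 0]; and some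
   state [phi1] on [<E1, E1>] has [phi1 (|x|) > 0]. A common bounding state [phi]
   would satisfy [0 < m phi1 (|x|) <= phi (|x|) <= M phi2 (|x|^2)^(1/2) = 0].
   Apply this to [z] and to [x = z - z a], where [a = <z, z>]: [a] is invertible,
   while [<x, x> = (1 - a) a (1 - a)] is not, because [1 = ||a||] is in the
   spectrum of the positive element [a]. Hence [x = 0], so [a = <z, z a> = a^2]
   and [a = 1].

   The spectral radius formula is avoided: if [h] is selfadjoint and [||h|| <= 1],
   then [1 - h^2] has a square root given by a convergent iteration, and
   [||x^2|| <= ||x^2 + y^2||] for commuting selfadjoint [x], [y]. *)

Require Import Defs.
From mathcomp Require Import all_boot all_order all_algebra.
From mathcomp Require Import complex.
From mathcomp Require Import boolp classical_sets reals.
From mathcomp Require Import topology normedtype.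
From mathcomp Require Import ereal ring lra.

Set Implicit Arguments.
Unset Strict Implicit.
Unset Printing Implicit Defensive.

Import Order.TTheory GRing.Theory Num.Theory.
Import numFieldNormedType.Exports.

Local Open Scope classical_set_scope.
Local Open Scope complex_scope.
Local Open Scope ring_scope.

(** * Real-valued norms and limits *)

Section RealNorm.
Context {R : realType} {V : normedModType R[i]}.
Implicit Types (x y : V) (r : R).

(** The norm takes values in [R[i]]; its real part is an element of [R], so that [lra] can settle
    estimates. *)
Definition nrm x : R := complex.Re `|x|.

Lemma nrmE x : `|x| = (nrm x)%:C.
Proof. by rewrite /nrm RRe_real// normr_real. Qed.

Lemma nrm_ge0 x : 0 <= nrm x.
Proof. by rewrite -ler0c -nrmE. Qed.

Lemma nrmD x y : nrm (x + y) <= nrm x + nrm y.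
Proof. by rewrite -lecR rmorphD /= -!nrmE ler_normD. Qed.

Lemma nrmN x : nrm (- x) = nrm x.
Proof. by rewrite /nrm normrN. Qed.

Lemma nrmB x y : nrm (x - y) <= nrm x + nrm y.
Proof. by rewrite -(nrmN y) nrmD. Qed.

Lemma nrm_distC x y : nrm (x - y) = nrm (y - x).
Proof. by rewrite -nrmN opprB. Qed.

Lemma nrm_distD z x y : nrm (x - y) <= nrm (x - z) + nrm (z - y).
Proof. by rewrite -[x - y](subrKA z) nrmD. Qed.

Lemma nrm0 : nrm (0 : V) = 0.
Proof. by rewrite /nrm normr0. Qed.

Lemma nrm0_eq0 x : nrm x = 0 -> x = 0.
Proof. by move=> x0; apply/eqP; rewrite -normr_eq0 nrmE x0. Qed.

Lemma nrm_gt0 x : x != 0 -> 0 < nrm x.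
Proof. by move=> x0; rewrite -ltcR -nrmE normr_gt0. Qed.

Lemma nrmZ (k : R[i]) x : nrm (k *: x) = complex.Re `|k| * nrm x.
Proof.
by apply: complexI; rewrite -nrmE normrZ nrmE rmorphM /= RRe_real// normr_real.
Qed.

Lemma nrmZr r x : nrm (r%:C *: x) = `|r| * nrm x.
Proof. by rewrite nrmZ normc_def /= expr0n /= addr0 sqrtr_sqr. Qed.

Lemma small_nrm0 x : (forall e, 0 < e -> nrm x <= e) -> x = 0.
Proof.
move=> small; apply: nrm0_eq0; apply/eqP; rewrite eq_le nrm_ge0 andbT.
by apply/ler_addgt0Pl => e /small; rewrite addr0.
Qed.

End RealNorm.

(** [t] is nondecreasing and bounded, so its distance to its supremum controls the tails of [y], and
    completeness of [V] applies. Both the Neumann series and the square root iteration converge by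
    this. *)
Lemma bounded_variation_limit (R : realType) (V : completeNormedModType R[i])
    (y : nat -> V) (t : nat -> R) (M : R) :
    (forall n, nrm (y n.+1 - y n) <= t n.+1 - t n) -> (forall n, t n <= M) ->
  exists l, forall e, 0 < e ->
    exists N, forall n, (N <= n)%N -> nrm (l - y n) <= e.
Proof.
move=> yt tM.
have dist n k : nrm (y (n + k)%N - y n) <= t (n + k)%N - t n.
  elim: k => [|k IHk]; first by rewrite addn0 !subrr nrm0.
  rewrite addnS; have := yt (n + k)%N.
  have := nrm_distD (y (n + k)%N) (y (n + k).+1) (y n).
  lra.
have t_has_sup : has_sup (range t) by split; [exists (t 0%N), 0%N|exists M => _ [n _ <-]].
have tail e : 0 < e -> exists N, forall n, (N <= n)%N -> nrm (y n - y N) <= e.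
  move=> e0; have [_ [N _ <-] hN] := sup_adherent e0 t_has_sup.
  exists N => n /subnKC <-; have := dist N (n - N)%N.
  have : t (N + (n - N))%N <= sup (range t) 
    by apply: ub_le_sup; [case: t_has_sup|exists (N + (n - N))%N].
  lra.
have : cvg (y @ \oo).
  apply/cauchy_cvgP/cauchy_exP => e; rewrite ltcE => /andP[/eqP ei e0].
  (* Balls are given by a strict inequality and [tail] by a weak one: hence the half. *)
  have e2 : 0 < complex.Re e / 2 by rewrite divr_gt0.
  have [N hN] := tail _ e2; exists (y N), N => // n /= Nn.
  rewrite -ball_normE /= distrC nrmE ltcE /= eq_sym ei eqxx /=.
  by have := hN _ Nn; rewrite /= in e0; lra.
move=> /cvg_ex[l yl]; exists l => e e0.
have eC : 0 < e%:C by rewrite ltcR.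
have /cvgrPdist_le/(_ _ eC)[N _ hN] := yl.
by exists N => n /hN /=; rewrite nrmE lecR.
Qed.

Lemma addrDKl (V : zmodType) (x y z : V) : x + y - (x + z) = y - z.
Proof. by rewrite opprD addrACA subrr add0r. Qed.

(** * Invertible elements of a C*-algebra *)

Section CStarBasics.
Context {R : realType} {A : cstarAlgType R}.
Implicit Types (a b x y : A) (r : R).

Lemma starK a : star (star a) = a. Proof. exact: cstar_starK. Qed.
Lemma starD a b : star (a + b) = star a + star b. Proof. exact: cstar_starD. Qed.
Lemma starM a b : star (a * b) = star b * star a. Proof. exact: cstar_starM. Qed.
Lemma starZ (k : R[i]) a : star (k *: a) = k^* *: star a.
Proof. exact: cstar_starZ. Qed.
Lemma starZr r a : star (r%:C *: a) = r%:C *: star a.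
Proof. by rewrite starZ; congr (_ *: _); exact: conjc_real. Qed.
Lemma starN a : star (- a) = - star a.
Proof. by rewrite -scaleN1r starZ rmorphN rmorph1 scaleN1r. Qed.
Lemma starB a b : star (a - b) = star a - star b.
Proof. by rewrite starD starN. Qed.
Lemma star0 : star (0 : A) = 0.
Proof. by rewrite -[0 in LHS](subrr 0) starB subrr. Qed.
Lemma star1 : star (1 : A) = 1.
Proof. by rewrite -[LHS]mul1r -{1}[1]starK -starM mul1r starK. Qed.

Lemma nrmM a b : nrm (a * b) <= nrm a * nrm b.
Proof. by rewrite -lecR rmorphM /= -!nrmE; exact: cstar_normM. Qed.

Lemma nrm_starM a : nrm (star a * a) = nrm a ^+ 2.
Proof. by apply: complexI; rewrite rmorphXn /= -!nrmE; exact: cstar_norm_star. Qed.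

Lemma nrm_star a : nrm (star a) = nrm a.
Proof.
have le_star b : nrm b <= nrm (star b).
  have [->|/nrm_gt0 b0] := eqVneq b 0; first by rewrite star0.
  by rewrite -(ler_pM2r b0) -expr2 -nrm_starM nrmM.
by apply/eqP; rewrite eq_le le_star -{2}[a]starK le_star.
Qed.

Lemma nrm_sq a : star a = a -> nrm (a * a) = nrm a ^+ 2.
Proof. by move=> sa; rewrite -{1}sa nrm_starM. Qed.

Lemma nrm1 : nrm (1 : A) = 1.
Proof.
have /mulfI: nrm (1 : A) != 0 by rewrite gt_eqF// nrm_gt0// oner_neq0.
by apply; rewrite mulr1 -expr2 -nrm_sq ?star1// mulr1.
Qed.

Lemma nrm_scalar r : nrm (r%:C%:A : A) = `|r|.
Proof. by rewrite nrmZr nrm1 mulr1. Qed.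

Lemma star_scalar r : star (r%:C%:A : A) = r%:C%:A.
Proof. by rewrite starZr star1. Qed.

Definition invertible a := exists b, b * a = 1 /\ a * b = 1.

Lemma invertibleZ (k : R[i]) a : k != 0 -> invertible (k *: a) <-> invertible a.
Proof.
move=> k0; split=> -[b].
- by rewrite -scalerAl -scalerAr=> -[ba ab]; exists (k *: b); rewrite -scalerAr -scalerAl.
- move=> [ba ab]; exists (k^-1 *: b).
  rewrite -!scalerAl -!scalerAr ba ab !scalerA.
  by rewrite mulVf// mulfV// scale1r.
Qed.

Lemma invertibleM a b : invertible a -> invertible b -> invertible (a * b).
Proof.
move=> [a' [a'a aa']] [b' [b'b bb']]; exists (b' * a'); split.
- by rewrite -mulrA (mulrA a') a'a mul1r.
- by rewrite -mulrA (mulrA b) bb' mul1r.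
Qed.

(** If [c] inverts [a * b], then [c * b] is a left and [b * c] a right inverse of [a]; they
    coincide. *)
Lemma invertible_factor a b :
  a * b = b * a -> invertible (a * b) -> invertible a.
Proof.
move=> ab [c [cab abc]].
have cba : c * b = b * c.
  by rewrite -[c * b]mulr1 -abc !mulrA -(mulrA c b a) -ab cab mul1r.
exists (b * c); split; last by rewrite mulrA.
by rewrite -cba -mulrA -ab.
Qed.

Lemma invertible_commute a c z :
  c * a = 1 -> a * c = 1 -> z * a = a * z -> z * c = c * z.
Proof.
move=> ca ac za.
by rewrite -[z * c]mul1r -ca -!mulrA (mulrA a) -za -mulrA ac mulr1.
Qed.

(** Formally [1 + ba + baba + ... = 1 + b (1 + ab + ...) a], which suggests the inverse. Hence
    [a * b] and [b * a] have the same nonzero spectrum. *)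
Lemma invertible_swap (a b : A) : invertible (1 - a * b) -> invertible (1 - b * a).
Proof.
move=> [c [cl cr]]; exists (1 + b * c * a).
have cab : c * (a * b) = c - 1 by rewrite -cl mulrBr mulr1 opprB addrC subrK.
have abc : a * b * c = c - 1 by rewrite -cr mulrBl mul1r opprB addrC subrK.
split.
- have e : b * c * a * (b * a) = b * c * a - b * a.
    have -> : b * c * a * (b * a) = b * (c * (a * b)) * a by rewrite !mulrA.
    by rewrite cab mulrBr mulrBl mulr1.
  by rewrite mulrBr mulr1 mulrDl mul1r e [b * a + _]addrC subrK addrK.
- have e : b * a * (b * c * a) = b * c * a - b * a.
    have -> : b * a * (b * c * a) = b * (a * b * c) * a by rewrite !mulrA.
    by rewrite abc mulrBr mulrBl mulr1.
  by rewrite mulrBl mul1r mulrDr mulr1 e [b * a + _]addrC subrK addrK.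
Qed.

(* The iterates [1, 1 + k, 1 + k (1 + k), ...] are the partial sums of the
   Neumann series. *)
Lemma neumann (k : A) : nrm k < 1 -> invertible (1 - k).
Proof.
move=> k1; pose r := nrm k.
have r0 : 0 <= r by exact: nrm_ge0.
pose s := fix s (n : nat) : A := if n is m.+1 then 1 + k * s m else 1.
pose t := fix t (n : nat) : R := if n is m.+1 then 1 + r * t m else 1.
have st n : nrm (s n.+1 - s n) <= t n.+1 - t n.
  elim: n => [|n IHn]; first by rewrite /= !mulr1 !(addrC 1) !addrK.
  rewrite [s n.+2]/= [s n.+1 in X in nrm X]/= [t n.+2]/= [t n.+1 in X in _ <= X]/=.
  rewrite !addrDKl -!mulrBr (le_trans (nrmM _ _))//.
  by rewrite ler_wpM2l.
(* The bound is the fixed point of [t' = 1 + r t], the sum of the geometric series. *)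
have tM n : t n <= (1 - r)^-1.
  have r1 : 0 < 1 - r by rewrite subr_gt0.
  elim: n => [|n IHn] /=; first by rewrite invf_ge1// gerBl.
  have -> : (1 - r)^-1 = 1 + r * (1 - r)^-1.
    by have := mulfV (lt0r_neq0 r1); lra.
  by rewrite lerD2l ler_wpM2l.
have [l sl] := bounded_variation_limit st tM.
have sk n : s n * k = k * s n.
  by elim: n => [|n IHn] /=; rewrite ?mulr1 ?mul1r// mulrDl mulrDr mulr1 mul1r -mulrA IHn.
have lk : l = 1 + k * l.
  apply/eqP; rewrite -subr_eq0; apply/eqP/small_nrm0 => e e0.
  have [N hN] := sl _ (divr_gt0 e0 (ltr0n _ 2)).
  have := nrm_distD (s N.+1) l (1 + k * l).
  have -> : s N.+1 - (1 + k * l) = k * (s N - l) by rewrite /= addrDKl mulrBr.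
  have := nrmM k (s N - l); have := hN _ (leqnn N); have := hN _ (leqnSn N).
  rewrite (nrm_distC (s N)) -/r => h1 h2 h3 h4.
  have := ler_pM r0 (nrm_ge0 (l - s N)) (ltW k1) (lexx _); lra.
have kl : k * l = l * k.
  apply/eqP; rewrite -subr_eq0; apply/eqP/small_nrm0 => e e0.
  have [N hN] := sl _ (divr_gt0 e0 (ltr0n _ 2)); have {}hN := hN _ (leqnn N).
  have := nrm_distD (k * s N) (k * l) (l * k).
  have -> : k * s N - l * k = (s N - l) * k by rewrite mulrBl sk.
  rewrite -mulrBr; have := nrmM k (l - s N); have := nrmM (s N - l) k.
  rewrite (nrm_distC (s N)) -/r => h1 h2 h3.
  have := ler_pM r0 (nrm_ge0 (l - s N)) (ltW k1) (lexx _); lra.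
exists l; split.
- by rewrite mulrBr mulr1 -kl {1}lk addrK.
- by rewrite mulrBl mul1r {1}lk addrK.
Qed.

End CStarBasics.

(** * Square roots and positive elements *)

Section PositiveCone.
Context {R : realType} {A : cstarAlgType R}.
Implicit Types (a b c h k u v x y z : A) (r s : R).

(* The iteration [y' = (k + y^2) / 2] increases, in norm, no faster than the
   scalar iteration [t' = (1 + t^2) / 2], which is bounded by [1]. *)
Lemma sqrt_one_sub k : star k = k -> nrm k <= 1 ->
  exists u, [/\ star u = u, u * u = 1 - k, nrm (1 - u) <= 1 &
    forall z, z * k = k * z -> z * u = u * z].
Proof.
move=> sk k1; pose half : R := 2^-1.
have halfE : half = 1 / 2 by rewrite /half div1r.
have [y [y0 yS]] : exists y : nat -> A,
    y 0%N = 0 /\ forall n, y n.+1 = half%:C *: (k + y n * y n).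
  by exists (fix y n := if n is m.+1 then half%:C *: (k + y m * y m) else 0).
have [t [t0 tS]] : exists t : nat -> R,
    t 0%N = 0 /\ forall n, t n.+1 = half * (1 + t n * t n).
  by exists (fix t n := if n is m.+1 then half * (1 + t m * t m) else 0).
have nhalf x : nrm (half%:C *: x) = half * nrm x.
  by rewrite nrmZr ger0_norm// halfE; lra.
have halfD x : half%:C *: x + half%:C *: x = x.
  rewrite -scalerDl -rmorphD /= halfE.
  by have -> : 1 / 2 + 1 / 2 = 1 :> R; [lra|rewrite scale1r].
rewrite {}/half in halfE tS yS nhalf halfD.
have t01 n : 0 <= t n <= 1.
  elim: n => [|n /andP[tn0 tn1]]; first by rewrite t0 lexx ler01.
  by rewrite tS; have := ler_pM tn0 tn0 tn1 tn1; have := mulr_ge0 tn0 tn0; lra.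
have yt n : nrm (y n) <= t n.
  elim: n => [|n IHn]; first by rewrite y0 t0 nrm0.
  rewrite yS tS nhalf; have := nrmD k (y n * y n); have := nrmM (y n) (y n).
  by have := ler_pM (nrm_ge0 _) (nrm_ge0 _) IHn IHn; lra.
have dyt n : nrm (y n.+1 - y n) <= t n.+1 - t n.
  elim: n => [|n IHn].
    by rewrite yS tS y0 t0 !subr0 nhalf !mulr0 !addr0; lra.
  (* The identity [p p - q q = p (p - q) + (p - q) q] holds without commutation of [p] and [q]. *)
  have -> : y n.+2 - y n.+1 =
      (2^-1)%:C *: (y n.+1 * (y n.+1 - y n) + (y n.+1 - y n) * y n).
    rewrite (yS n.+1) [X in _ - X]yS -scalerBr addrDKl mulrBr mulrBl.
    by rewrite addrA subrK.
  have -> : t n.+2 - t n.+1 =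
      2^-1 * (t n.+1 * (t n.+1 - t n) + (t n.+1 - t n) * t n).
    by rewrite (tS n.+1) [X in _ - X]tS; ring.
  rewrite nhalf ler_wpM2l ?invr_ge0//.
  apply: (le_trans (nrmD _ _)); apply: lerD; apply: (le_trans (nrmM _ _)).
  - by rewrite ler_pM ?nrm_ge0.
  - by rewrite ler_pM ?nrm_ge0.
have [l yl] := bounded_variation_limit dyt (fun n => proj2 (andP (t01 n))).
have l1 : nrm l <= 1.
  apply/ler_addgt0Pl => e /yl[N /(_ _ (leqnn N)) hN].
  have := nrm_distD (y N) l 0; rewrite !subr0; have := yt N; have /andP[_] := t01 N.
  lra.
(* The limit satisfies [l = (k + l^2) / 2], that is [(1 - l)^2 = 1 - k]; so [u = 1 - l]. *)
have lE : l + l = k + l * l.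
  apply/eqP; rewrite -subr_eq0; apply/eqP/small_nrm0 => e e0.
  (* Four errors: [l - y N.+1] twice, and [y N - l] in two products whose other factor has norm at
     most [1]. *)
  have [N hN] := yl _ (divr_gt0 e0 (ltr0n _ 4)).
  have h1 := hN _ (leqnn N); have h2 := hN _ (leqnSn N).
  have -> : l + l - (k + l * l) = (l - y N.+1) + (l - y N.+1)
      + (y N * (y N - l) + (y N - l) * l).
    have -> : y N * (y N - l) + (y N - l) * l = y N * y N - l * l.
      by rewrite mulrBr mulrBl addrA subrK.
    have -> : (l - y N.+1) + (l - y N.+1) = l + l - (k + y N * y N).
      by rewrite addrACA -opprD [y N.+1]yS halfD.
    rewrite -[RHS]addrA; congr (_ + _).
    by rewrite !opprD -[RHS]addrA addKr.
  have := nrmD (l - y N.+1 + (l - y N.+1)) (y N * (y N - l) + (y N - l) * l).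
  have := nrmD (l - y N.+1) (l - y N.+1).
  have := nrmD (y N * (y N - l)) ((y N - l) * l).
  have := nrmM (y N) (y N - l); have := nrmM (y N - l) l.
  rewrite (nrm_distC (y N)); have /andP[_ tN] := t01 N.
  have := ler_pM (nrm_ge0 _) (nrm_ge0 (l - y N)) (le_trans (yt N) tN) (lexx _).
  have := ler_pM (nrm_ge0 _) (nrm_ge0 (l - y N)) l1 (lexx _).
  lra.
have sy n : star (y n) = y n.
  by elim: n => [|n IHn]; rewrite ?y0 ?star0// yS starZr starD starM IHn sk.
have sl : star l = l.
  apply/eqP; rewrite -subr_eq0; apply/eqP/small_nrm0 => e e0.
  have [N /(_ _ (leqnn N)) hN] := yl _ (divr_gt0 e0 (ltr0n _ 2)).
  have := nrm_distD (y N) (star l) l.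
  rewrite -{1}sy -starB nrm_star (nrm_distC (y N)); lra.
exists (1 - l); split.
- by rewrite starB star1 sl.
- by rewrite mulrBr mulr1 mulrBl mul1r -addrA -opprD addrA lE addrK.
- by rewrite opprB addrC subrK.
- move=> z zk.
  have zy n : z * y n = y n * z.
    elim: n => [|n IHn]; first by rewrite y0 mulr0 mul0r.
    by rewrite yS -scalerAr -scalerAl mulrDr mulrDl zk mulrA IHn -mulrA IHn mulrA.
  suff zl : z * l = l * z by rewrite mulrBr mulrBl mulr1 mul1r zl.
  apply/eqP; rewrite -subr_eq0; apply/eqP/small_nrm0 => e e0.
  (* Two products with [z] must each stay below [e / 2]; the [+ 1] keeps the divisor positive when
     [z = 0]. *)
  have z0 : 0 < 2 * (nrm z + 1) by have := nrm_ge0 z; lra.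
  have [N /(_ _ (leqnn N)) hN] := yl _ (divr_gt0 e0 z0).
  have -> : z * l - l * z = z * (l - y N) - (l - y N) * z.
    by rewrite mulrBr mulrBl zy opprB addrA subrK.
  have := nrmB (z * (l - y N)) ((l - y N) * z).
  have := nrmM z (l - y N); have := nrmM (l - y N) z.
  move: hN; rewrite ler_pdivlMr// => hN.
  have := nrm_ge0 (l - y N); lra.
Qed.

Lemma nrm_sq_le_sum x y : star x = x -> star y = y -> x * y = y * x ->
  nrm (x * x) <= nrm (x * x + y * y).
Proof.
move=> sx sy xy; pose w : A := x + 'i *: y.
have sw : star w = x - 'i *: y.
  by rewrite starD sx starZ sy -scaleNr; congr (_ + _ *: _); exact: conjCi.
have <- : star w * w = x * x + y * y.
  rewrite sw /w mulrDr !mulrBl -!scalerAl -!scalerAr xy scalerA.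
  by rewrite -(expr2 'i) sqrCi scaleN1r addrA subrK opprK.
rewrite nrm_starM nrm_sq// ler_sqr ?nnegrE ?nrm_ge0//.
have := nrmD w (star w); rewrite nrm_star sw /w addrACA subrr addr0.
have -> : x + x = 2%:C *: x by rewrite -mulr2n -scaler_nat rmorph_nat.
by rewrite nrmZr ger0_norm// mulr2n mulrDl mul1r; lra.
Qed.

Lemma scalarD r s : (r + s)%:C%:A = r%:C%:A + s%:C%:A :> A.
Proof. by rewrite rmorphD scalerDl. Qed.

Lemma scalarB r s : (r - s)%:C%:A = r%:C%:A - s%:C%:A :> A.
Proof. by rewrite rmorphB scalerBl. Qed.

Lemma scalar0 : (0 : R)%:C%:A = 0 :> A.
Proof. by rewrite scale0r. Qed.

Lemma scalar1 : (1 : R)%:C%:A = 1 :> A.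
Proof. by rewrite scale1r. Qed.

Lemma scalar_comm r x : r%:C%:A * x = x * r%:C%:A.
Proof. by rewrite mulr_algl mulr_algr. Qed.

Lemma scalerKr r x : r != 0 -> r%:C *: ((r^-1)%:C *: x) = x.
Proof. by move=> r0; rewrite scalerA -rmorphM /= mulfV// scale1r. Qed.

Lemma realC_neq0 r : r != 0 -> r%:C != 0 :> R[i].
Proof. by apply: contraNneq => -[->]. Qed.

Lemma neumann_scalar r k : nrm k < r -> invertible (r%:C%:A - k).
Proof.
move=> kr; have r0 : 0 < r by rewrite (le_lt_trans (nrm_ge0 k)).
have -> : r%:C%:A - k = r%:C *: (1 - (r^-1)%:C *: k).
  by rewrite scalerBr scalerKr ?gt_eqF.
apply/invertibleZ; first by rewrite realC_neq0 ?gt_eqF.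
by apply: neumann; rewrite nrmZr gtr0_norm ?invr_gt0// mulrC ltr_pdivrMr// mul1r.
Qed.

(* If [c (1 - h^2) = 1] and [d > 0] is small, then [1 - h^2 - d] is the square
   of [u w], where [u] and [w] are roots of [1 - h^2] and [1 - d c], so that
   [h^2 + (u w)^2 = 1 - d]. *)
Lemma nrm_lt1_of_invertible h : star h = h -> nrm h <= 1 ->
  invertible (1 - h * h) -> nrm h < 1.
Proof.
move=> sh h1 [c [cl cr]].
have shh : star (h * h) = h * h by rewrite starM sh.
have s1hh : star (1 - h * h) = 1 - h * h by rewrite starB star1 shh.
have hh1 : nrm (h * h) <= 1.
  by apply: (le_trans (nrmM h h)); have := ler_pM (nrm_ge0 h) (nrm_ge0 h) h1 h1; lra.
have [u [su uu _ uC]] := sqrt_one_sub shh hh1.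
have sc : star c = c.
  have : star c * (1 - h * h) = 1 by rewrite -{1}s1hh -starM cr star1.
  by move=> scl; rewrite -[LHS]mulr1 -cr mulrA scl mul1r.
(* Small enough that [d <= 1] and that [d c] has norm at most [1], as [sqrt_one_sub] requires. *)
pose d := (nrm c + 1)^-1.
have c0 := nrm_ge0 c.
have d0 : 0 < d by rewrite invr_gt0; lra.
have d1 : d <= 1 by rewrite invf_le1; lra.
have sdc : star (d%:C *: c) = d%:C *: c by rewrite starZr sc.
have dc1 : nrm (d%:C *: c) <= 1.
  by rewrite nrmZr gtr0_norm// mulrC ler_pdivrMr; lra.
have [w [sw ww _ wC]] := sqrt_one_sub sdc dc1.
have hu : h * u = u * h by apply: uC; rewrite mulrA.
have hhh : h * (1 - h * h) = (1 - h * h) * h by rewrite mulrBr mulrBl mulr1 mul1r mulrA.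
have hc : h * c = c * h by apply: (invertible_commute cl cr).
have uc : u * c = c * u.
  by apply: (invertible_commute cl cr); rewrite -uu mulrA.
have hw : h * w = w * h by apply: wC; rewrite -scalerAl -scalerAr hc.
have uw : u * w = w * u by apply: wC; rewrite -scalerAl -scalerAr uc.
have e : h * h + (u * w) * (u * w) = (1 - d)%:C%:A.
  have -> : (u * w) * (u * w) = (u * u) * (w * w).
    by rewrite -!mulrA (mulrA w u) -uw !mulrA.
  rewrite uu ww mulrBr mulr1 -scalerAr cr addrA (addrC (h * h)) subrK.
  by rewrite scalarB scalar1.
have := nrm_sq_le_sum sh (y := u * w).
rewrite starM su sw -uw e nrm_scalar ger0_norm ?subr_ge0// => /(_ erefl).
have -> : h * (u * w) = u * w * h by rewrite mulrA hu -mulrA hw mulrA.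
move=> /(_ erefl); rewrite nrm_sq// => hd.
have : nrm h ^+ 2 < 1 ^+ 2 by rewrite expr1n; lra.
by rewrite ltr_sqr// nnegrE ?ler01 ?nrm_ge0.
Qed.

(** After rescaling to norm one this is the contrapositive of [nrm_lt1_of_invertible]. It stands in
    for the spectral radius of [h]. *)
Lemma norm_attained h : star h = h -> h != 0 ->
  ~ invertible ((nrm h ^+ 2)%:C%:A - h * h).
Proof.
move=> sh /nrm_gt0; set r := nrm h => r0 hI.
have rV : 0 < r^-1 by rewrite invr_gt0.
have h1 : nrm ((r^-1)%:C *: h) = 1 by rewrite nrmZr gtr0_norm// mulVf// gt_eqF.
suff : nrm ((r^-1)%:C *: h) < 1 by rewrite h1 ltxx.
apply: nrm_lt1_of_invertible; rewrite ?h1// ?starZr ?sh//.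
rewrite -scalerAl -scalerAr scalerA.
have -> : 1 = ((r^-1)%:C * (r^-1)%:C) *: (r ^+ 2)%:C%:A :> A.
  rewrite scalerA -!rmorphM /= expr2 mulrA -(mulrA r^-1) mulVf ?gt_eqF// mulr1.
  by rewrite mulVf ?gt_eqF// scale1r.
rewrite -scalerBr; apply/invertibleZ => //.
by rewrite -rmorphM /= realC_neq0 ?mulf_neq0 ?gt_eqF.
Qed.

(* For selfadjoint [a] this is equivalent to nonnegativity of the spectrum
   ([cstar_pos_cone], [pos_cone_cstar_pos]), but is visibly a convex cone. *)
Definition pos_cone a := star a = a /\ exists r, 0 <= r /\ nrm (r%:C%:A - a) <= r.

Lemma pos_cone_scalar r : 0 <= r -> pos_cone (r%:C%:A).
Proof. by move=> r0; split; [rewrite star_scalar|exists r; rewrite subrr nrm0]. Qed.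

Lemma pos_coneD a b : pos_cone a -> pos_cone b -> pos_cone (a + b).
Proof.
move=> [sa [r [r0 ar]]] [sb [s [s0 bs]]]; split; first by rewrite starD sa sb.
exists (r + s); split; first by rewrite addr_ge0.
by rewrite scalarD opprD addrACA (le_trans (nrmD _ _))// lerD.
Qed.

Lemma pos_coneZ s a : 0 <= s -> pos_cone a -> pos_cone (s%:C *: a).
Proof.
move=> s0 [sa [r [r0 ar]]]; split; first by rewrite starZr sa.
exists (s * r); split; first by rewrite mulr_ge0.
by rewrite rmorphM -scalerA -scalerBr nrmZr ger0_norm// ler_wpM2l.
Qed.

(** Neumann series: [s + a = (s + r) - (r - a)], where [r - a] has norm at most [r < s + r]. *)
Lemma pos_cone_invertible s a : 0 < s -> pos_cone a -> invertible (s%:C%:A + a).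
Proof.
move=> s0 [_ [r [r0 ar]]].
have -> : s%:C%:A + a = (s + r)%:C%:A - (r%:C%:A - a).
  by rewrite scalarD opprB addrACA subrr addr0.
by apply: neumann_scalar; lra.
Qed.

Lemma pos_cone_nrmD h : star h = h -> pos_cone ((nrm h)%:C%:A + h).
Proof.
move=> sh; split; first by rewrite starD star_scalar sh.
by exists (nrm h); rewrite nrm_ge0 opprD addrA subrr add0r nrmN.
Qed.

Lemma pos_cone_nrmB h : star h = h -> pos_cone ((nrm h)%:C%:A - h).
Proof. by move=> sh; rewrite -(nrmN h); apply: pos_cone_nrmD; rewrite starN sh. Qed.

(** If [r > 0], write [a = r (1 - k)] with [k] of norm at most [1] and rescale the root of [1 - k];
    if [r = 0], then [a = 0]. *)
Lemma pos_cone_sqrt a : pos_cone a ->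
  exists v, [/\ star v = v, pos_cone v, v * v = a &
    forall z, z * a = a * z -> z * v = v * z].
Proof.
move=> [sa [r [r0 ar]]]; move: r0; rewrite le_eqVlt => /predU1P[r0|r0].
  have a0 : a = 0.
    apply: nrm0_eq0; apply/eqP; rewrite eq_le nrm_ge0 andbT.
    by move: ar; rewrite -r0 scalar0 sub0r nrmN.
  have P0 : pos_cone 0 by rewrite -scalar0; apply: pos_cone_scalar.
  by exists 0; split=> [||| z _] //; rewrite ?star0 ?mulr0 ?mul0r ?a0.
have rV : 0 < r^-1 by rewrite invr_gt0.
pose k := 1 - (r^-1)%:C *: a.
have sk : star k = k by rewrite starB star1 starZr sa.
have k1 : nrm k <= 1.
  have -> : k = (r^-1)%:C *: (r%:C%:A - a).
    by rewrite scalerBr scalerA -rmorphM /= mulVf ?gt_eqF// scale1r.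
  by rewrite nrmZr gtr0_norm// mulrC ler_pdivrMr// mul1r.
have [u [su uu u1 uC]] := sqrt_one_sub sk k1.
exists ((Num.sqrt r)%:C *: u); split.
- by rewrite starZr su.
- split; first by rewrite starZr su.
  exists (Num.sqrt r); rewrite sqrtr_ge0 -scalerBr nrmZr ger0_norm ?sqrtr_ge0//.
  by split=> //; rewrite -[leRHS]mulr1 ler_wpM2l// sqrtr_ge0.
- rewrite -scalerAl -scalerAr scalerA -rmorphM /= -expr2 sqr_sqrtr ?ltW// uu.
  by rewrite /k opprB addrC subrK scalerKr ?gt_eqF.
- move=> z za; rewrite -scalerAl -scalerAr uC// /k mulrBr mulrBl mulr1 mul1r.
  by rewrite -scalerAl -scalerAr za.
Qed.

(** The radius is the norm of [k^2]: with [u^2 = |k^2| - k^2], [nrm_sq_le_sum] bounds [u^2] by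
    [u^2 + k^2], a scalar. *)
Lemma pos_cone_sq k : star k = k -> pos_cone (k * k).
Proof.
move=> sk; have skk : star (k * k) = k * k by rewrite starM sk.
split=> //; exists (nrm (k * k)); rewrite nrm_ge0; split=> //.
have [u [su _ uu uC]] := pos_cone_sqrt (pos_cone_nrmB skk).
have e : u * u + k * k = (nrm (k * k))%:C%:A by rewrite uu subrK.
have ku : u * k = k * u.
  by apply/esym/uC; rewrite mulrBr mulrBl scalar_comm mulrA.
rewrite -{1}e addrK (le_trans (nrm_sq_le_sum su sk ku))//.
by rewrite e nrm_scalar ger0_norm// nrm_ge0.
Qed.

(** Apply [norm_attained] to a square root of [a]. *)
Lemma pos_cone_norm_attained a : pos_cone a -> a != 0 ->
  ~ invertible ((nrm a)%:C%:A - a).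
Proof.
move=> /pos_cone_sqrt[v [sv _ <- _]] vv0; rewrite nrm_sq//.
by apply: norm_attained => //; apply: contraNneq vv0 => ->; rewrite mul0r.
Qed.

(* [w w^* + w^* w] is a sum of two squares, so [w w^*] is positive along with
   [- w^* w]; and [w w^*], [w^* w] have the same nonzero spectrum. *)
Lemma pos_cone_neg_starM w : pos_cone (- (star w * w)) -> w = 0.
Proof.
move=> negP; set k := - (star w * w) in negP.
have [k0|k0] := eqVneq k 0.
  move/eqP: k0; rewrite oppr_eq0 => /eqP ww0; apply: nrm0_eq0; apply/eqP.
  by rewrite -sqrf_eq0 -nrm_starM ww0 nrm0.
have [] := pos_cone_norm_attained negP k0.
have := nrm_gt0 k0; set s := nrm k => s0.
have wwP : pos_cone (w * star w).
  (* Up to sign, twice the real and imaginary parts of [w]; thus [x^2 + y^2 = 2 (w w^* + w^* w)]. *)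
  pose x := w + star w; pose y := 'i *: (w - star w).
  have sx : star x = x by rewrite starD starK addrC.
  have sy : star y = y.
    rewrite starZ starB starK -(opprB w) scalerN -scaleNr; congr (_ *: _).
    by rewrite -[RHS]opprK; congr (- _); exact: conjCi.
  have e : x * x + y * y + 2%:C *: k = 2%:C *: (w * star w).
    have -> : x * x + y * y = 2%:C *: (w * star w + star w * w).
      rewrite /x /y -scalerAl -scalerAr scalerA -(expr2 'i) sqrCi scaleN1r.
      rewrite !(mulrDl, mulrDr, mulNr, mulrN, opprD, opprK).
      rewrite addrACA (addrACA (w * w)) subrr add0r [X in _ + X]addrACA subrr addr0.
      by rewrite rmorph_nat scaler_nat mulr2n addrACA.
    by rewrite -scalerDr addrK.
  have -> : w * star w = (2^-1)%:C *: (x * x + y * y + 2%:C *: k).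
    by rewrite e scalerA -rmorphM /= mulVf ?pnatr_eq0// scale1r.
  apply: pos_coneZ; rewrite ?invr_ge0//; apply: pos_coneD.
    by apply: pos_coneD; apply: pos_cone_sq.
  exact: pos_coneZ.
(* What remains is to invert [s - k = s + w^* w]; swapping the factors reduces this to
   [s + w w^*]. *)
have sI := pos_cone_invertible s0 wwP.
have factor x : s%:C%:A + x = s%:C *: (1 - (- (s^-1)%:C *: x)).
  by rewrite scaleNr opprK scalerDr scalerKr ?gt_eqF.
have sC : s%:C != 0 by rewrite realC_neq0 ?gt_eqF.
move: sI; rewrite opprK !factor => /(invertibleZ _ sC).
rewrite scalerAr => /invertible_swap.
by rewrite -scalerAl => ?; apply/invertibleZ.
Qed.

(* Kaplansky's argument: if [b = |h| - h] is twice the negative part of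
   [h = y^* y], then [- (y b)^* (y b) = |h| b^2] is positive, so that [y b = 0],
   hence [b = 0]. *)
Lemma pos_cone_starM y : pos_cone (star y * y).
Proof.
set h := star y * y.
have sh : star h = h by rewrite starM starK.
have [m [sm mP mm mC]] := pos_cone_sqrt (pos_cone_sq sh).
have hm : h * m = m * h by apply: mC; rewrite mulrA.
pose b := m - h.
have sb : star b = b by rewrite starB sm sh.
have bm : b * m = m * b by rewrite mulrBl mulrBr hm.
have bh : b * h = - (m * b).
  by rewrite mulrBl mulrBr mm opprB.
have [v [sv _ vv vC]] := pos_cone_sqrt mP.
have bv : b * v = v * b by apply: vC.
have yb0 : y * b = 0.
  apply: pos_cone_neg_starM.
  have -> : - (star (y * b) * (y * b)) = (v * b) * (v * b).
    rewrite starM sb mulrA -(mulrA b) -/h bh mulNr opprK -vv.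
    by rewrite -!mulrA (mulrA b v) bv -!mulrA.
  by apply: pos_cone_sq; rewrite starM sv sb bv.
have hb0 : h * b = 0 by rewrite /h -mulrA yb0 mulr0.
have bb0 : b * b = 0.
  have hb : h * b = b * h by rewrite mulrBl mulrBr hm.
  by rewrite {1}/b mulrBl hb0 subr0 -[LHS]opprK -bh -hb hb0 oppr0.
have b0 : b = 0.
  by apply: nrm0_eq0; apply/eqP; rewrite -sqrf_eq0 -nrm_sq// bb0 nrm0.
by move/eqP: b0; rewrite subr_eq0 => /eqP <-.
Qed.

End PositiveCone.

(** * Agreement of the cone with positivity of the spectrum *)

Section SpectralPositivity.
Context {R : realType} {A : cstarAlgType R}.
Implicit Types a b : A.

Lemma scalar_sqrB (s : R) a :
  (s ^+ 2)%:C%:A - a * a = (s%:C%:A - a) * (s%:C%:A + a).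
Proof.
rewrite mulrBl !mulrDr !mulr_algl mulr_algr opprD addrA addrK scalerA.
by rewrite -rmorphM expr2.
Qed.

(** Suppose [h = r - a] has norm [s > r]. Then [s^2 - h^2] is not invertible, but both its factors
    are: [s - h = a - (r - s)] because [r - s < 0] is outside the spectrum, and
    [s + h = (s + r) - a] by the Neumann series. *)
Lemma cstar_pos_cone a : cstar_pos a -> pos_cone a.
Proof.
move=> [sa spec]; split=> //; set r := nrm a; exists r; split; first exact: nrm_ge0.
rewrite leNgt; apply/negP; set h := r%:C%:A - a; set s := nrm h => rs.
have r0 : 0 <= r by exact: nrm_ge0.
have sh : star h = h by rewrite starB star_scalar sa.
have h0 : h != 0 by apply: contraTneq rs => h0; rewrite /s h0 nrm0 -leNgt.
have [] := norm_attained sh h0; rewrite -/s.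
rewrite scalar_sqrB; apply: invertibleM.
- have -> : s%:C%:A - h = a - (r - s)%:C%:A.
    by rewrite scalarB /h opprB addrC opprB addrA addrAC.
  apply: contrapT => /(spec (r - s)%:C) /=.
  by rewrite ler0c; lra.
- have -> : s%:C%:A + h = (s + r)%:C%:A - a by rewrite scalarD addrA.
  by apply: neumann_scalar; rewrite -/r; lra.
Qed.

(** It is a factor of [(a - i y) (a + i y) = y^2 + a^2], a positive scalar plus a square. *)
Lemma invertible_sub_im (y : R) a : star a = a -> y != 0 ->
  invertible (a - ('i * y%:C)%:A).
Proof.
move=> sa y0; apply: (@invertible_factor _ _ _ (a + ('i * y%:C)%:A)).
  rewrite [LHS]mulrDr !mulrBl [RHS]mulrBr !mulrDl !mulr_algl !mulr_algr.
  by rewrite addrA subrK opprD addrA addrK.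
have -> : (a - ('i * y%:C)%:A) * (a + ('i * y%:C)%:A) = (y ^+ 2)%:C%:A + a * a.
  rewrite mulrDr !mulrBl !mulr_algr !mulr_algl addrA subrK scalerA addrC.
  by rewrite mulrACA -(expr2 'i) sqrCi mulN1r scaleNr opprK -rmorphM expr2.
by apply: pos_cone_invertible; [rewrite exprn_even_gt0|exact: pos_cone_sq].
Qed.

Lemma pos_cone_cstar_pos a : pos_cone a -> cstar_pos a.
Proof.
move=> aP; have [sa _] := aP; split=> // k /= kspec.
pose x := complex.Re k; pose y := complex.Im k.
have kE : k = x%:C + 'i * y%:C by exact: complexE.
pose w := a - x%:C%:A.
have sw : star w = w by rewrite starB star_scalar sa.
have [y0|y0] := eqVneq y 0; last first.
  case: kspec; have -> : a - k%:A = w - ('i * y%:C)%:A.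
    by rewrite /w kE scalerDl opprD addrA.
  exact: invertible_sub_im.
have {}kE : k = x%:C by rewrite kE y0 rmorph0 mulr0 addr0.
rewrite kE ler0c leNgt; apply/negP => x0; case: kspec; rewrite kE.
have -> : a - x%:C%:A = (- x)%:C%:A + a by rewrite rmorphN scaleNr addrC.
by apply: pos_cone_invertible => //; rewrite oppr_gt0.
Qed.

Lemma cstar_sqrtP a : cstar_pos a ->
  cstar_pos (cstar_sqrt a) /\ cstar_sqrt a ^+ 2 = a.
Proof.
move=> /cstar_pos_cone/pos_cone_sqrt[v [_ vP vv _]].
rewrite /cstar_sqrt; case: xgetP => [b _ //|/(_ v)[]].
by split; [exact: pos_cone_cstar_pos|rewrite expr2].
Qed.

End SpectralPositivity.

(** * Extreme linear minorants of a sublinear functional *)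

Section ExtremeMinorant.
Context {R : realType} {V : lmodType R[i]}.
Implicit Types (f p q : V -> R) (x y : V) (s t : R).

(** The inequality for [t > 0] suffices: using it for [t] and for its inverse gives equality, and
    [q 0 = 0]. *)
Definition real_sublinear q :=
  (forall x y, q (x + y) <= q x + q y) /\
  (forall t x, 0 < t -> q (t%:C *: x) <= t * q x).

Definition real_linear f :=
  (forall x y, f (x + y) = f x + f y) /\ (forall t x, f (t%:C *: x) = t * f x).

Lemma real_sublinear0 q : real_sublinear q -> q 0 = 0.
Proof.
move=> [_ qZ]; have := qZ 2 0; have := qZ 2^-1 0.
by rewrite !scaler0 invr_gt0 ltr0n => /(_ isT) + /(_ isT); lra.
Qed.

Lemma real_sublinearZ q t x : real_sublinear q -> 0 <= t ->
  q (t%:C *: x) = t * q x.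
Proof.
move=> qS; rewrite le_eqVlt => /predU1P[<-|t0].
  by rewrite scale0r mul0r real_sublinear0.
have [_ qZ] := qS; apply/eqP; rewrite eq_le qZ//= mulrC -ler_pdivlMr// mulrC.
have tV : 0 < t^-1 by rewrite invr_gt0.
by have := qZ _ (t%:C *: x) tV; rewrite scalerA -rmorphM /= mulVf ?gt_eqF// scale1r.
Qed.

Lemma real_sublinear_oppr_ge q x : real_sublinear q -> - q (- x) <= q x.
Proof.
by move=> qS; have := qS.1 x (- x); rewrite subrr (real_sublinear0 qS); lra.
Qed.

Lemma real_linear_opp f x : real_linear f -> f (- x) = - f x.
Proof. by move=> [_ /(_ (-1) x)]; rewrite rmorphN scaleN1r mulN1r. Qed.

Lemma real_linear_le_eq f g : real_linear f -> real_linear g ->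
  (forall x, f x <= g x) -> f = g.
Proof.
move=> fL gL fg; apply/funext => x; apply/eqP; rewrite eq_le fg /=.
by have := fg (- x); rewrite !real_linear_opp// lerN2.
Qed.

Context (p : V -> R).

(* The linear [f <= q] form a face of the convex set of the linear [f <= p]. *)
Definition facial q := [/\ real_sublinear q, forall x, q x <= p x &
  forall t f1 f2, 0 < t < 1 -> real_linear f1 -> real_linear f2 ->
    (forall x, f1 x <= p x) -> (forall x, f2 x <= p x) ->
    (forall x, t * f1 x + (1 - t) * f2 x <= q x) ->
    (forall x, f1 x <= q x) /\ (forall x, f2 x <= q x)].

(** The lower bound of a chain for Zorn's lemma: its pointwise infimum, finite because [- p (- x)]
    lies below every member at [x]. *)
Lemma facial_chain_inf (C : set (V -> R)) : C !=set0 ->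
  (forall q, C q -> facial q) ->
  (forall q1 q2, C q1 -> C q2 ->
     (forall x, q1 x <= q2 x) \/ (forall x, q2 x <= q1 x)) ->
  exists q, facial q /\ forall q', C q' -> forall x, q x <= q' x.
Proof.
move=> [q0 Cq0] CF Ctot; pose q x := inf [set q' x | q' in C].
have lb x : lbound [set q' x | q' in C] (- p (- x)).
  move=> _ [q' /CF[qS qp _] <-]; have := real_sublinear_oppr_ge x qS.
  by have := qp (- x); lra.
have ne x : [set q' x | q' in C] !=set0 by exists (q0 x), q0.
have q_le q' x : C q' -> q x <= q' x.
  by move=> Cq; apply: ge_inf; [exists (- p (- x))|exists q'].
have q_ge x s : (forall q', C q' -> s <= q' x) -> s <= q x.
  by move=> h; apply: lb_le_inf => // _ [q' /h ? <-].
exists q; split=> [|q' Cq x]; last exact: q_le.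
split.
- split=> [x y|t x t0].
  + rewrite -lerBlDr; apply: (q_ge) => q1 C1; rewrite lerBlDr -lerBlDl.
    apply: (q_ge) => q2 C2; rewrite lerBlDl.
    (* The smaller of the two members, evaluated at [x + y], bounds the infimum there. *)
    have [h|h] := Ctot _ _ C1 C2.
    * have [[qD _] _ _] := CF _ C1; have := q_le _ (x + y) C1.
      by have := qD x y; have := h y; lra.
    * have [[qD _] _ _] := CF _ C2; have := q_le _ (x + y) C2.
      by have := qD x y; have := h x; lra.
  + rewrite mulrC -ler_pdivrMr//; apply: (q_ge) => q' Cq; rewrite ler_pdivrMr//.
    have [[_ qZ] _ _] := CF _ Cq; rewrite mulrC.
    exact: le_trans (q_le _ _ Cq) (qZ _ _ t0).
- by move=> x; apply: le_trans (q_le _ x Cq0) _; have [_ + _] := CF _ Cq0; exact.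
- move=> t f1 f2 t01 L1 L2 p1 p2 fq.
  have h q' : C q' -> (forall x, f1 x <= q' x) /\ (forall x, f2 x <= q' x).
    move=> Cq; have [_ _ fac] := CF _ Cq; apply: (fac t) => // x.
    exact: le_trans (fq x) (q_le _ x Cq).
  by split=> x; apply: (q_ge) => q' /h[].
Qed.

(* The face of [q] on which [f a] takes its maximal value [q a]. *)
Lemma facial_exposed q (a : V) : facial q ->
  exists q', [/\ facial q', forall x, q' x <= q x & q' (- a) <= - q a].
Proof.
move=> [qS qp qF].
(* A linear [f <= q] with [f a = q a] satisfies [f x = f (x + t a) - t f a <= q (x + t a) - t q
   a]. *)
pose S x := [set q (x + t%:C *: a) - t * q a | t in [set t : R | 0 <= t]].
pose q' x := inf (S x).
have lb x : lbound (S x) (- q (- x)).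
  move=> _ [t /= t0 <-]; have := qS.1 (x + t%:C *: a) (- x).
  rewrite addrAC subrr add0r (real_sublinearZ _ qS t0); lra.
have ne x : S x !=set0 by exists (q (x + 0%:C *: a) - 0 * q a), 0 => /=.
have q_le t x : 0 <= t -> q' x <= q (x + t%:C *: a) - t * q a.
  by move=> t0; apply: ge_inf; [exists (- q (- x))|exists t].
have q_ge x s : (forall t, 0 <= t -> s <= q (x + t%:C *: a) - t * q a) -> s <= q' x.
  by move=> h; apply: lb_le_inf => // _ [t /h ? <-].
have q'q x : q' x <= q x by have := q_le 0 x (lexx _); rewrite scale0r addr0; lra.
exists q'; split=> //; last first.
  by have := q_le 1 (- a) ler01; rewrite scale1r addNr (real_sublinear0 qS); lra.
split.
- split=> [x y|t x t0].
  + rewrite -lerBlDr; apply: (q_ge) => t t0; rewrite lerBlDr -lerBlDl.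
    apply: (q_ge) => s s0; rewrite lerBlDl.
    apply: (le_trans (q_le (t + s) (x + y) (addr_ge0 t0 s0))).
    rewrite rmorphD /= scalerDl addrACA.
    by have := qS.1 (x + t%:C *: a) (y + s%:C *: a); lra.
  + rewrite mulrC -ler_pdivrMr//; apply: (q_ge) => s s0; rewrite ler_pdivrMr//.
    apply: (le_trans (q_le (t * s) _ (mulr_ge0 (ltW t0) s0))).
    by rewrite rmorphM /= -scalerA -scalerDr (real_sublinearZ _ qS (ltW t0)); lra.
- by move=> x; exact: le_trans (q'q x) (qp x).
- move=> t f1 f2 t01 L1 L2 p1 p2 fq; have /andP[t0 t1] := t01.
  have [q1 q2] : (forall x, f1 x <= q x) /\ (forall x, f2 x <= q x).
    by apply: (qF t) => // x; exact: le_trans (fq x) (q'q x).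
  (* The bound by [q'] at [- a]. As neither [f1 a] nor [f2 a] exceeds [q a], both equal it. *)
  have ga : q a <= t * f1 a + (1 - t) * f2 a.
    have := fq (- a); have := q_le 1 (- a) ler01.
    rewrite scale1r addNr (real_sublinear0 qS).
    rewrite (real_linear_opp _ L1) (real_linear_opp _ L2).
    by lra.
  have f1a : f1 a = q a.
    by apply/eqP; rewrite eq_le q1 /=; have := q2 a; have := q1 a; nra.
  have f2a : f2 a = q a.
    by apply/eqP; rewrite eq_le q2 /=; have := q2 a; have := q1 a; nra.
  split=> x; apply: (q_ge) => s s0.
  + by have := q1 (x + s%:C *: a); rewrite L1.1 L1.2 f1a; lra.
  + by have := q2 (x + s%:C *: a); rewrite L2.1 L2.2 f2a; lra.
Qed.

(* A minimal facial functional is odd, since its exposed faces are not smaller;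
   being sublinear, it is linear, and it is extreme because its face is a point.
   This replaces the Hahn-Banach, Banach-Alaoglu and Krein-Milman theorems. *)
Lemma extreme_minorant : real_sublinear p ->
  exists f, [/\ real_linear f, forall x, f x <= p x &
    forall t f1 f2, 0 < t < 1 -> real_linear f1 -> real_linear f2 ->
      (forall x, f1 x <= p x) -> (forall x, f2 x <= p x) ->
      (forall x, f x = t * f1 x + (1 - t) * f2 x) -> f1 = f /\ f2 = f].
Proof.
move=> pS; pose T := {q : V -> R | facial q}.
have pF : facial p by split=> // t f1 f2 *.
(* The order is reversed, so that a maximal element is a pointwise minimal functional. *)
have [|||C Ctot|[q qF] qmin] :=
    @Zorn T (fun q1 q2 : T => `[< forall x, sval q2 x <= sval q1 x >]).
- by move=> q; apply/asboolP.
- move=> q1 q2 q3 /asboolP h1 /asboolP h2; apply/asboolP => x.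
  exact: le_trans (h2 x) (h1 x).
- move=> [q1 F1] [q2 F2] /asboolP /= h1 /asboolP /= h2.
  by apply: eq_exist; apply/funext => x; apply/eqP; rewrite eq_le h1 h2.
- have [[q0 Cq0]|C0] := pselect (C !=set0); last first.
    by exists (exist _ p pF) => s Cs; case: C0; exists s.
  have [|||q [qF qC]] := @facial_chain_inf [set sval s | s in C].
  + by exists (sval q0), q0.
  + by move=> _ [s _ <-]; exact: svalP.
  + move=> _ _ [s1 C1 <-] [s2 C2 <-].
    by have [/asboolP|/asboolP] := Ctot _ _ C1 C2; [right|left].
  by exists (exist _ q qF) => s Cs; apply/asboolP => x; apply: qC; exists s.
have [qS qp fac] := qF.
have qN x : q (- x) = - q x.
  have [q' [q'F q'q q'x]] := facial_exposed x qF.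
  have := qmin (exist _ q' q'F); rewrite asboolT// => /(_ isT)/(f_equal sval) /= e.
  apply/eqP; rewrite eq_le -[q in X in X <= _]e q'x /=.
  by have := real_sublinear_oppr_ge x qS; rewrite lerNl.
have qL : real_linear q.
  split=> [x y|t x].
  - apply/eqP; rewrite eq_le qS.1 /= -lerN2 -qN opprD.
    by have := qS.1 (- x) (- y); rewrite !qN; lra.
  - have [t0|t0] := leP 0 t; first exact: real_sublinearZ.
    rewrite -[t]opprK rmorphN scaleNr qN real_sublinearZ//; last by lra.
    by rewrite !mulNr.
exists q; split=> // t f1 f2 t01 L1 L2 p1 p2 qE.
have [|h1 h2] := fac t f1 f2 t01 L1 L2 p1 p2; first by move=> x; rewrite qE.
by split; exact: real_linear_le_eq.
Qed.

End ExtremeMinorant.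

(** * States and pure states *)

Section ComplexParts.
Context {R : realType}.
Implicit Types (z w : R[i]) (t : R).

Lemma Re_add z w : complex.Re (z + w) = complex.Re z + complex.Re w.
Proof. by case: z; case: w. Qed.

Lemma Re_realM t z : complex.Re (t%:C * z) = t * complex.Re z.
Proof. by case: z => x y /=; rewrite mul0r subr0. Qed.

Lemma Re_iM z : complex.Re ('i * z) = - complex.Im z.
Proof. by case: z => x y /=; rewrite mul0r mul1r sub0r. Qed.

Lemma normC_real t : `|t%:C| = `|t|%:C :> R[i].
Proof. by rewrite normc_def /= expr0n /= addr0 sqrtr_sqr. Qed.

Lemma ge0_ReE z : 0 <= z -> z = (complex.Re z)%:C.
Proof. by rewrite lecE => /andP[/eqP z0 _]; case: z z0 => x y /= ->. Qed.

Lemma Re_ge0 z : 0 <= z -> 0 <= complex.Re z.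
Proof. by rewrite lecE => /andP[]. Qed.

End ComplexParts.

(** * Positive functionals and their norms *)

Section PositiveFunctionals.
Context {R : realType} {A : cstarAlgType R}.
Implicit Types (a b c h x y : A) (s t : R) (psi : A -> R[i]).

Lemma linear_onD psi a b : linear_on setT psi -> psi (a + b) = psi a + psi b.
Proof. by move=> /(_ 1 a b I I); rewrite scale1r mul1r. Qed.

Lemma linear_on0 psi : linear_on setT psi -> psi 0 = 0.
Proof. by move=> L; apply: (addrI (psi 0)); rewrite -linear_onD// !addr0. Qed.

Lemma linear_onZ psi (k : R[i]) a : linear_on setT psi -> psi (k *: a) = k * psi a.
Proof. by move=> L; rewrite -[k *: a]addr0 L// linear_on0// addr0. Qed.

Lemma linear_onN psi a : linear_on setT psi -> psi (- a) = - psi a.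
Proof. by move=> L; rewrite -scaleN1r linear_onZ// mulN1r. Qed.

Section PositiveFunctional.
Context (psi : A -> R[i]).
Context (psiL : linear_on setT psi) (psiP : positive_on setT psi).

Lemma positive_pos_cone a : pos_cone a -> 0 <= psi a.
Proof. by move=> /pos_cone_sqrt[v [sv _ <- _]]; rewrite -{1}sv; apply: psiP. Qed.

(** Both [1] and [|h| + h], with [|h|] the norm, are in the cone, so [psi] is real at each. *)
Lemma positive_sa_real h : star h = h -> psi h = (complex.Re (psi h))%:C.
Proof.
move=> sh; have := positive_pos_cone (pos_cone_nrmD sh).
rewrite linear_onD// linear_onZ//.
have := positive_pos_cone (pos_cone_scalar ler01); rewrite scalar1.
rewrite !lecE => /andP[/eqP i1 _] /andP[/eqP + _].
move: i1; case: (psi 1) => u v; case: (psi h) => x y /= ->.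
by rewrite mulr0 mul0r !add0r => ->.
Qed.

Lemma positive_star a : psi (star a) = (psi a)^*%C.
Proof.
have sD : star (a + star a) = a + star a by rewrite starD starK addrC.
have sB : star ('i *: (a - star a)) = 'i *: (a - star a).
  rewrite starZ starB starK -(opprB a) scalerN -scaleNr; congr (_ *: _).
  by rewrite -[RHS]opprK; congr (- _); exact: conjCi.
have := positive_sa_real sD; have := positive_sa_real sB.
rewrite linear_onZ// !linear_onD// linear_onN//.
case: (psi a) => x y; case: (psi (star a)) => u v /= [e1] [e2].
by congr Complex; lra.
Qed.

Lemma positive_Re_le a : complex.Re (psi a) <= complex.Re (psi 1) * nrm a.
Proof.
have sD : star (a + star a) = a + star a by rewrite starD starK addrC.
have := positive_pos_cone (pos_cone_nrmB sD) => /Re_ge0.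
rewrite linear_onD// linear_onN// linear_onZ// linear_onD// positive_star Re_add Re_realM.
have := positive_pos_cone (pos_cone_scalar ler01); rewrite scalar1 => /Re_ge0.
have := nrmD a (star a); rewrite nrm_star; case: (psi a) => x y /=; nra.
Qed.

Lemma positive_norm_le a : complex.Re `|psi a| <= complex.Re (psi 1) * nrm a.
Proof.
have [->|pa0] := eqVneq (psi a) 0.
  rewrite normr0 mulr_ge0 ?nrm_ge0//.
  by apply: Re_ge0; rewrite -scalar1; apply/positive_pos_cone/pos_cone_scalar.
(* A phase of modulus one that makes [psi (k *: a)] real and nonnegative. *)
pose k := `|psi a| / psi a.
have -> : `|psi a| = psi (k *: a) by rewrite linear_onZ// /k mulfVK.
have <- : nrm (k *: a) = nrm a.
  by rewrite nrmZ /k normrM normfV normr_id mulfV ?normr_eq0// mul1r.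
exact: positive_Re_le.
Qed.

(** The supremum is attained at the unit; hence states are the positive functionals with value [1]
    there. *)
Lemma positive_norm_on : norm_on setT psi = (complex.Re (psi 1))%:E.
Proof.
have one0 : 0 <= psi 1.
  by rewrite -scalar1; apply/positive_pos_cone/pos_cone_scalar.
apply/eqP; rewrite eq_le; apply/andP; split.
- apply: ge_ereal_sup => _ [b [_ b1] <-]; rewrite lee_fin.
  apply: le_trans (positive_norm_le b) _; rewrite -[leRHS]mulr1.
  by rewrite ler_wpM2l ?Re_ge0// -lecR -nrmE.
- apply: ereal_sup_ubound; exists 1; last by rewrite ger0_norm.
  by split=> //; rewrite nrmE nrm1.
Qed.

End PositiveFunctional.

Lemma state1 psi : state psi -> psi 1 = 1.
Proof.
case=> L P; rewrite positive_norm_on// => -[e].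
have := positive_pos_cone P (pos_cone_scalar ler01).
by rewrite scalar1 => /ge0_ReE ->; rewrite e.
Qed.

Lemma state_of_one psi : linear_on setT psi -> positive_on setT psi ->
  psi 1 = 1 -> state psi.
Proof. by move=> L P p1; split; rewrite ?positive_norm_on// p1. Qed.

End PositiveFunctionals.

(** * A pure state vanishing at a positive noninvertible element *)

Section PureStates.
Context {R : realType} {A : cstarAlgType R}.
Context (c : A) (cP : pos_cone c) (cI : ~ invertible c).
Implicit Types (a b h x y : A) (s t : R) (psi : A -> R[i]).

Definition repart x : A := (2^-1)%:C *: (x + star x).

Lemma repart_sa h : star h = h -> repart h = h.
Proof.
move=> sh; rewrite /repart sh scalerDr -scalerDl -rmorphD /=.
by have -> : 2^-1 + 2^-1 = 1 :> R; [lra|rewrite scale1r].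
Qed.

Lemma star_repart x : star (repart x) = repart x.
Proof. by rewrite starZr starD starK addrC. Qed.

Lemma repartD x y : repart (x + y) = repart x + repart y.
Proof. by rewrite /repart starD addrACA scalerDr. Qed.

Lemma repartZ t x : repart (t%:C *: x) = t%:C *: repart x.
Proof. by rewrite /repart starZr -scalerDr !scalerA mulrC. Qed.

Lemma nrm_repart x : nrm (repart x) <= nrm x.
Proof.
rewrite nrmZr ger0_norm ?invr_ge0//.
by have := nrmD x (star x); rewrite nrm_star; lra.
Qed.

(** Noninvertibility of [c] enters here: for [t < 0], [s c] would be the positive scalar [- t] plus
    an element of the cone. *)
Lemma pos_cone_shift_ge0 s t : 0 <= s -> pos_cone (t%:C%:A + s%:C *: c) -> 0 <= t.
Proof.
move=> s0 tsP; rewrite leNgt; apply/negP => t0.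
have : invertible (s%:C *: c).
  have -> : s%:C *: c = (- t)%:C%:A + (t%:C%:A + s%:C *: c).
    by rewrite rmorphN scaleNr addKr.
  by apply: pos_cone_invertible => //; rewrite oppr_gt0.
have [->|s1] := eqVneq s 0.
  rewrite scale0r => -[b [+ _]]; rewrite mulr0 => /esym/eqP.
  by rewrite oner_eq0.
by move/invertibleZ => /(_ (realC_neq0 s1)).
Qed.

(* Real parts of the states vanishing at [c] are the real-linear functionals
   below [state_gauge]. *)
Definition gauge_set x : set R :=
  [set t | exists2 s, 0 <= s & pos_cone (t%:C%:A + s%:C *: c - repart x)].
Definition state_gauge x : R := inf (gauge_set x).

(** Adding [|h| + h], for [h = repart x] with norm [|h|], to [t + s c - h] leaves [(|h| + t) + s c]
    in the cone. The infimum is therefore finite. *)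
Lemma gauge_set_lb x : lbound (gauge_set x) (- nrm x).
Proof.
move=> t [s s0 tP].
suff : 0 <= nrm (repart x) + t by have := nrm_repart x; lra.
apply: (pos_cone_shift_ge0 s0).
have := pos_coneD (pos_cone_nrmD (star_repart x)) tP.
by rewrite addrACA subrr addr0 addrA -scalarD.
Qed.

Lemma state_gauge_le x t s : 0 <= s ->
  pos_cone (t%:C%:A + s%:C *: c - repart x) -> state_gauge x <= t.
Proof.
move=> s0 tP; apply: ge_inf; last by exists s.
by exists (- nrm x); exact: gauge_set_lb.
Qed.

Lemma state_gauge_le0 x t : pos_cone (t%:C%:A - repart x) -> state_gauge x <= t.
Proof. by move=> tP; apply: (@state_gauge_le _ _ 0); rewrite ?scale0r ?addr0. Qed.

Lemma state_gauge_ge x r :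
  (forall t s, 0 <= s -> pos_cone (t%:C%:A + s%:C *: c - repart x) -> r <= t) ->
  r <= state_gauge x.
Proof.
move=> h; apply: lb_le_inf => [|t [s]]; last exact: h.
exists (nrm (repart x)), 0 => //; rewrite scale0r addr0.
exact/pos_cone_nrmB/star_repart.
Qed.

Lemma state_gauge_sublinear : real_sublinear state_gauge.
Proof.
split=> [x y|r x r0].
- rewrite -lerBlDr; apply: state_gauge_ge => t s s0 tP; rewrite lerBlDr -lerBlDl.
  apply: state_gauge_ge => t' s' s'0 tP'; rewrite lerBlDl.
  apply: (@state_gauge_le _ _ (s + s')); first exact: addr_ge0.
  have := pos_coneD tP tP'; congr pos_cone.
  by rewrite repartD scalarD rmorphD /= scalerDl addrACA -opprD (addrACA t%:C%:A).
- rewrite mulrC -ler_pdivrMr//; apply: state_gauge_ge => t s s0 tP.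
  rewrite ler_pdivrMr//; apply: (@state_gauge_le _ _ (r * s)).
    by rewrite mulr_ge0// ltW.
  have := pos_coneZ (ltW r0) tP; congr pos_cone.
  by rewrite repartZ scalerBr scalerDr (mulrC t) !rmorphM /= -!scalerA.
Qed.

Lemma state_le_gauge psi : state psi -> psi c = 0 ->
  forall x, complex.Re (psi x) <= state_gauge x.
Proof.
move=> psiS pc x; have [L P _] := psiS; apply: state_gauge_ge => t s s0 tP.
have := Re_ge0 (positive_pos_cone P tP).
rewrite !(linear_onD _ _ L) (linear_onN _ L) !(linear_onZ _ _ L) state1// pc mulr0 addr0.
rewrite (linear_onD _ _ L) positive_star// mulr1 Re_add.
case: (psi x) => u v /=; rewrite mul0r subr0; lra.
Qed.

Lemma state_Re_linear psi : state psi -> real_linear (fun x => complex.Re (psi x)).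
Proof.
by case=> L _ _; split=> [x y|t x]; rewrite ?linear_onD ?linear_onZ// (Re_add, Re_realM).
Qed.

(** A complex-linear functional is recovered from its real part [f] as [f x - i f (i x)]. *)
Lemma state_Re_inj psi f : state psi -> (fun x => complex.Re (psi x)) = f ->
  psi = fun x => Complex (f x) (- f ('i *: x)).
Proof.
case=> L _ _ <-; apply/funext => x.
by rewrite linear_onZ// Re_iM opprK; case: (psi x).
Qed.

(** The gauge is at most [0] at [- h] for [h] in the cone, at skew-adjoint elements and at [c], and
    at most [1] at [1] and [-1] at [- 1]. This gives positivity, vanishing on skew-adjoint elements,
    [f c = 0] and [f 1 = 1]. *)
Lemma gauge_linear_state f : real_linear f -> (forall x, f x <= state_gauge x) ->
  state (fun x => Complex (f x) (- f ('i *: x))) /\ f c = 0.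
Proof.
move=> fL fp.
have f_ge0 h : pos_cone h -> 0 <= f h.
  move=> hP; rewrite -oppr_le0 -(real_linear_opp _ fL); apply: le_trans (fp _) _.
  apply: state_gauge_le0; rewrite scalar0 sub0r repart_sa ?opprK//.
  by rewrite starN hP.1.
have f_skew h : star h = - h -> f h = 0.
  have le0 h' : star h' = - h' -> f h' <= 0.
    move=> sh; apply: le_trans (fp _) _; apply: state_gauge_le0.
    by rewrite /repart sh subrr scaler0 subr0; apply: pos_cone_scalar.
  move=> sh; apply/eqP; rewrite eq_le le0// -oppr_le0 -(real_linear_opp _ fL).
  by rewrite le0// starN sh.
have f_sa h : star h = h -> f ('i *: h) = 0.
  move=> sh; apply: f_skew; rewrite starZ sh -scaleNr; congr (_ *: _).
  exact: conjCi.
have f1 : f 1 = 1.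
  apply/eqP; rewrite eq_le; apply/andP; split.
    apply: le_trans (fp _) _; apply: state_gauge_le0.
    by rewrite repart_sa ?star1// scalar1 subrr -scalar0; apply: pos_cone_scalar.
  rewrite -lerN2 -(real_linear_opp _ fL); apply: le_trans (fp _) _.
  apply: state_gauge_le0; rewrite repart_sa ?starN ?star1// rmorphN scaleNr scalar1 subrr.
  by rewrite -scalar0; apply: pos_cone_scalar.
split; last first.
  apply/eqP; rewrite eq_le f_ge0// andbT; apply: le_trans (fp _) _.
  apply: (@state_gauge_le _ _ 1) => //.
  rewrite repart_sa ?cP.1// scale1r scalar0 add0r subrr -scalar0.
  exact: pos_cone_scalar.
have [fD fZ] := fL.
apply: state_of_one => [k a b _ _|b _|] /=; last by rewrite f1 f_sa ?star1// oppr0.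
- case: k => u v.
  have kE x : (u +i* v) *: x = u%:C *: x + v%:C *: ('i *: x).
    by rewrite scalerA -scalerDl mulrC; congr (_ *: _); exact: complexE.
  have ikE x : 'i *: ((u +i* v) *: x) = u%:C *: ('i *: x) + (- v)%:C *: x.
    rewrite kE scalerDr !scalerA mulrC; congr (_ + _ *: _).
    by rewrite mulrAC -(expr2 'i) sqrCi mulN1r rmorphN.
  rewrite scalerDr !fD ikE kE !fD !fZ.
  by apply/eqP; rewrite eq_complex /=; apply/andP; split; apply/eqP; ring.
- by rewrite f_sa ?starM ?starK// oppr0 lecE /= eqxx f_ge0//; apply: pos_cone_starM.
Qed.

(** An extreme minorant of the gauge is the real part of such a state. If it is a mixture of two
    states, their nonnegative values at [c] average to [0], so both vanish there, lie below the
    gauge, and extremality applies. *)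
Theorem exists_pure_state_vanishing : exists psi, pure_state psi /\ psi c = 0.
Proof.
have [f [fL fp fext]] := extreme_minorant state_gauge_sublinear.
have [fS fc] := gauge_linear_state fL fp.
exists (fun x => Complex (f x) (- f ('i *: x))).
have pc0 : Complex (f c) (- f ('i *: c)) = 0.
  have [L P _] := fS; have := positive_sa_real L P cP.1.
  by rewrite /= => ->; rewrite fc.
split=> //; split=> // t psi1 psi2 t01 S1 S2 e.
have /andP[t0 t1] := t01.
have [L1 P1 _] := S1; have [L2 P2 _] := S2.
have c1 := positive_pos_cone P1 cP; have c2 := positive_pos_cone P2 cP.
have ec : t * complex.Re (psi1 c) + (1 - t) * complex.Re (psi2 c) = 0.
  by rewrite -!Re_realM -Re_add -e pc0.
have r1 := Re_ge0 c1; have r2 := Re_ge0 c2.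
have z1 : psi1 c = 0 by rewrite (ge0_ReE c1); congr (_%:C); nra.
have z2 : psi2 c = 0 by rewrite (ge0_ReE c2); congr (_%:C); nra.
have [|h1 h2] := fext t _ _ t01 (state_Re_linear S1) (state_Re_linear S2)
  (state_le_gauge S1 z1) (state_le_gauge S2 z2).
  by move=> x; rewrite -!Re_realM -Re_add -e.
by split; exact: state_Re_inj.
Qed.

End PureStates.

(** * Normalised restrictions of states *)

Section Restriction.
Context {R : realType} {A : cstarAlgType R}.
Implicit Types (B : set A) (psi : A -> R[i]).

(** The factor is the inverse of the norm of [psi] on [B], which is positive because of [b] and at
    most [1]. *)
Lemma restrict_state B psi b : state psi ->
  (forall (k : R[i]) x, B x -> B (k *: x)) -> B b -> psi b != 0 ->
  exists2 r : R, 0 < r & state_on B (fun a => r%:C * psi a).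
Proof.
move=> psiS BZ Bb pb; have [L P _] := psiS.
pose X := [set (complex.Re `|psi b|)%:E | b in [set b | B b /\ `|b| <= 1]].
have b0 : b != 0 by apply: contraNneq pb => ->; rewrite linear_on0.
have nb := nrm_gt0 b0.
pose b' := ((nrm b)^-1)%:C *: b.
have Xb : X (complex.Re `|psi b'|)%:E.
  exists b' => //; split; first exact: BZ.
  by rewrite nrmE nrmZr gtr0_norm ?invr_gt0// mulVf ?gt_eqF.
have pb'0 : 0 < complex.Re `|psi b'|.
  have : 0 < `|psi b'|.
    by rewrite normr_gt0 linear_onZ// mulf_neq0// realC_neq0 ?invr_eq0 ?gt_eqF.
  by rewrite ltcE => /andP[].
have X1 : (ereal_sup X <= 1)%E.
  apply: ge_ereal_sup => _ [x [_ x1] <-]; rewrite lee_fin.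
  apply: le_trans (positive_norm_le L P x) _.
  by rewrite state1//= mul1r -lecR -nrmE.
have X0 := ereal_sup_ubound Xb.
have [N NE] : exists N, ereal_sup X = N%:E.
  case: (ereal_sup X) X0 X1 => [N _ _|//|//]; by exists N.
rewrite NE lee_fin in X0.
have N0 : 0 < N by apply: lt_le_trans X0.
have NV : 0 < N^-1 by rewrite invr_gt0.
exists N^-1 => //.
split.
- by move=> k x y _ _; rewrite L// mulrDr mulrCA.
- move=> x _; rewrite mulr_ge0//; last exact: P.
  by rewrite ler0c invr_ge0 ltW.
- have := ereal_sup_pZl X NV; rewrite NE -EFinM mulVf ?gt_eqF// => <-.
  congr ereal_sup; rewrite /X image_comp; apply: eq_imagel => x _.
  by rewrite /comp normrM normC_real Re_realM (gtr0_norm NV) EFinM.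
Qed.

End Restriction.

(** * Hilbert modules *)

Section InnerSpan.
Context {R : realType} {A : cstarAlgType R} {E : hilbertModType A}.
Implicit Types (F : set E) (x y : E).

Lemma inner_in_inner_span F x y : F x -> F y -> inner_span F (inner x y).
Proof.
move=> Fx Fy; apply: subset_closure => W [_]; apply; by exists x, y.
Qed.

Lemma inner_spanZ F (k : R[i]) (a : A) : inner_span F a -> inner_span F (k *: a).
Proof.
move=> Fa U /scaler_continuous /Fa [b [Fb Ub]]; exists (k *: b); split=> // W WS.
by have [[W0 WL] _] := WS; rewrite -[k *: b]addr0; apply: WL => //; exact: Fb.
Qed.

Lemma module_independentC F1 F2 : module_independent F1 F2 -> module_independent F2 F1.
Proof.
move=> [m [M [m0 M0 h]]]; exists m, M; split=> // p2 p1 S2 S1.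
by have [p [? ? ?]] := h _ _ S1 S2; exists p.
Qed.

Lemma pos_cone_inner x : pos_cone (inner x x).
Proof. exact/cstar_pos_cone/inner_pos. Qed.

Lemma modulusP x : pos_cone (modulus x) /\ modulus x ^+ 2 = inner x x.
Proof. by have [/cstar_pos_cone mP mm] := cstar_sqrtP (inner_pos x). Qed.

End InnerSpan.

(** * Invertibility of [<x, x>] for nonzero common elements *)

Section Independence.
Context {R : realType} {A : cstarAlgType R}.

(** With [|b|] the norm, [|b| b - b^2 = v (|b| - b) v] has the form [y^* y], so
    [0 <= psi (b^2) <= |b| psi b]. *)
Lemma state_vanish_sq (psi : A -> R[i]) (b : A) : state psi -> pos_cone b ->
  psi b = 0 -> psi (b * b) = 0.
Proof.
move=> [L P _] bP b0; have [v [sv _ vv _]] := pos_cone_sqrt bP.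
have [u [su _ uu _]] := pos_cone_sqrt (pos_cone_nrmB bP.1).
have e : star (u * v) * (u * v) = (nrm b)%:C *: b - b * b.
  have -> : b * b = v * b * v by rewrite -vv !mulrA.
  by rewrite starM su sv mulrA -(mulrA v u u) uu mulrBr mulrBl mulr_algr -scalerAl vv.
have := P (u * v) I; rewrite e linear_onD// linear_onZ// b0 mulr0 add0r linear_onN//.
rewrite oppr_ge0 => le0; apply/eqP; rewrite eq_le le0.
by rewrite -{1}bP.1; apply: P.
Qed.

Lemma independent_invertible (E : hilbertModType A) (E1 E2 : set E) (x : E) :
  module_independent E1 E2 -> quasi_extension_property (inner_span E2) ->
  E1 x -> E2 x -> x != 0 -> invertible (inner x x).
Proof.
move=> [m [M [m0 M0 indep]]] qep E1x E2x x0; apply: contrapT => cI.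
set c := inner x x in cI; have cP : pos_cone c := pos_cone_inner x.
have c0 : c != 0 by apply: contraNneq x0 => /inner_eq0/eqP.
have [psi [psiS psic]] := exists_pure_state_vanishing cP cI.
have [b B2b pb] : exists2 b, inner_span E2 b & psi b != 0.
  apply: contrapT => h; apply: qep; exists psi; split=> // b Bb.
  by apply/eqP/negPn/negP => pb; apply: h; exists b.
have [r2 r20 S2] := restrict_state psiS.1 (@inner_spanZ _ _ _ E2) B2b pb.
(* A state whose value at [c] is the norm of [c]: that norm is in the spectrum, so some state
   vanishes at the difference. *)
have [om [[omS _] omc]] := exists_pure_state_vanishing
  (pos_cone_nrmB cP.1) (pos_cone_norm_attained cP c0).
have [L P _] := omS.
have omcE : om c != 0.
  have : om ((nrm c)%:C%:A - c) + om c = (nrm c)%:C.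
    by rewrite -linear_onD// subrK linear_onZ// state1// mulr1.
  by rewrite omc add0r => ->; rewrite realC_neq0 ?gt_eqF ?nrm_gt0.
have [r1 r10 S1] := restrict_state omS (@inner_spanZ _ _ _ E1)
  (inner_in_inner_span E1x E1x) omcE.
have [phi [_ bd1 bd2]] := indep _ _ S1 S2.
have [mP mm] := modulusP x; rewrite -/c in mm.
have [lo _] := bd1 _ E1x; have [_ up] := bd2 _ E2x.
rewrite mm psic mulr0 sqrtC0 mulr0 in up.
have om0 := positive_pos_cone P mP.
have := le_trans lo up.
rewrite pmulr_rle0 ?ltcR// pmulr_rle0 ?ltcR// => om_le0.
(* The bounds force [om] to vanish at [|x|], hence at [|x|^2 = c]. *)
move/eqP: omcE; apply; rewrite -mm expr2; apply: state_vanish_sq => //.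
by apply/eqP; rewrite eq_le om_le0 om0.
Qed.

End Independence.

Theorem proposition2p13 (R : realType) (A : cstarAlgType R)
    (E : hilbertModType A) (E1 E2 : set E) (z : E)
    (tern1 : ternary_subspace E1) (tern2 : ternary_subspace E2)
    (indep : module_independent E1 E2)
    (qep : quasi_extension_property (inner_span E1) \/
           quasi_extension_property (inner_span E2))
    (z1 : E1 z) (z2 : E2 z) (normz : `|z| = 1) :
  modulus z = 1.
Proof.
have key x : E1 x -> E2 x -> x != 0 -> invertible (inner x x).
  move=> E1x E2x; case: qep => [q1|q2].
  - exact: (independent_invertible (module_independentC indep)).
  - exact: independent_invertible indep q2 _ _.
set a := inner z z.
have aP : pos_cone a := pos_cone_inner z.
have na : nrm a = 1 by rewrite /nrm -norm_inner normz expr1n.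
have z0 : z != 0 by rewrite -normr_gt0 normz.
have [a' [a'a _]] := key z z1 z2 z0; rewrite -/a in a'a.
(* Written in the form under which [subspace] asserts closure; ternarity puts [ract z a] in both
   subspaces. *)
pose x := (-1 : R[i]) *: ract z a + z.
have Ex F : ternary_subspace F -> F z -> F x.
  move=> [[_ FL] _ Fa] Fz; apply: FL => //; apply: Fa => //.
  exact: inner_in_inner_span.
have zx : inner z x = a - a * a.
  by rewrite innerD innerZ inner_ract scaleN1r addrC.
have x0 : x = 0.
  apply/eqP; apply: contrapT => /negP xn0.
  have a0 : a != 0 by rewrite -normr_eq0 nrmE na oner_neq0.
  have := pos_cone_norm_attained aP a0; rewrite na scalar1; apply.
  have xz : inner x z = a - a * a.
    by rewrite -inner_star zx starB starM aP.1.
  have xx : inner x x = (1 - a) * ((1 - a) * a).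
    rewrite {2}/x innerD innerZ inner_ract scaleN1r xz.
    rewrite !(mulrBr, mulrBl, mul1r, mulr1) mulrA opprB.
    by rewrite addrC.
  have := key x (Ex _ tern1 z1) (Ex _ tern2 z2) xn0; rewrite xx.
  apply: invertible_factor.
  by rewrite -mulrA; congr (_ * _); rewrite mulrBr mulrBl mul1r mulr1.
have a1 : a = 1.
  have : inner z x = 0 by rewrite x0 -(scale0r 0) innerZ scale0r.
  by rewrite zx => /eqP; rewrite subr_eq0 => /eqP aa; rewrite -a'a {2}aa mulrA a'a mul1r.
(* From [b^2 = 1] to [b = 1]: [(1 + b) (b - 1) = 0], and [1 + b] is invertible because [b] is
   positive. *)
have [bP bb] := modulusP z; set b := modulus z in bP bb *; rewrite -/a a1 in bb.
have [d [db _]] := pos_cone_invertible ltr01 bP.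
have e : (1 + b) * (b - 1) = 0.
  by rewrite mulrBr mulr1 mulrDl mul1r -expr2 bb (addrC b) subrr.
rewrite scalar1 in db.
by apply/eqP; rewrite -subr_eq0 -[_ - _]mul1r -{1}db -mulrA e mulr0.
Qed.
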